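(* Let $k$ be an algebraically closed field of characteristic $0$, let $t<n\le v$ be positive integers, let $(V,B)$ be a Steiner system of type $S(t,n,v)$ with $V=\{1,\dots,v\}$, and let $\mathcal H=\{H_1,\dots,H_v\}$ be a collection of $v$ distinct hyperplanes in $\mathbb P^n_k$ such that any $n$ of them meet in exactly one point and any $n+1$ of them have empty intersection. Let $I\subseteq k[x_0,\dots,x_n]$ be the ideal defining the Complement of the Steiner configuration of points associated to $(V,B)$ with respect to $\mathcal H$. Then Demailly's Conjecture holds for $I$, that is, for every integer $m\in\mathbb N$ and all integers $h>1$, $$\frac{\alpha(I^{(h)})}{h}\ \ge\ \frac{\alpha(I^{(m)})+n-1}{m+n-1}.$$
   Context: A Steiner system $(V,B)$ of type $S(t,n,v)$ is a set $V$ with $|V|=v$ together with a collection $B$ of $n$-element subsets of $V$ (blocks) such that each $t$-element subset of $V$ is contained in a unique block. Let $\ell_j\in k[x_0,\dots,x_n]$ be a linear form defining $H_j$. For an $n$-element subset $\sigma=\{\sigma_1,\dots,\sigma_n\}\subseteq V$, let $P_{\mathcal H,\sigma}=H_{\sigma_1}\cap\dots\cap H_{\sigma_n}$, a point of $\mathbb P^n_k$ with vanishing ideal $I_{P_{\mathcal H,\sigma}}=(\ell_{\sigma_1},\dots,\ell_{\sigma_n})$. Let $C_{(n,v)}$ be the set of all $n$-element subsets of $V$. The Complement of the Steiner configuration of points is $X_C=\bigcup_{\sigma\in C_{(n,v)}\setminus B}P_{\mathcal H,\sigma}$, with defining ideal $I=\bigcap_{\sigma\in C_{(n,v)}\setminus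 B}I_{P_{\mathcal H,\sigma}}$. For a radical ideal $I$, the $m$-th symbolic power is $I^{(m)}=\bigcap_{\mathfrak p\in \mathrm{Ass}(I)}\mathfrak p^m$. For a nonzero homogeneous ideal $J$, $\alpha(J)$ is the least degree $d$ such that $J_d\ne 0$.
   Formalization: The formal theorem also assumes that the configuration X_C is nonempty, which excludes only v = n: there B = {V}, I is the unit ideal, all α are 0, and the stated inequality would read 0 ≥ (n−1)/(m+n−1), false since n ≥ 2. *)

(* Defs.v *)
From mathcomp Require Import all_boot all_order all_algebra.
From mathcomp Require Import boolp classical_sets.
From mathcomp Require Import mpoly.

Set Implicit Arguments.
Unset Strict Implicit.
Unset Printing Implicit Defensive.

Import Order.TTheory GRing.Theory Num.Theory.

Local Open Scope classical_set_scope.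
Local Open Scope ring_scope.

Section Ideals.
Variable R : comNzRingType.

(* Ideals are classical sets: boolean membership in a finitely generated ideal
   would require a decision procedure. *)
Definition is_ideal (J : set R) : Prop :=
  [/\ J 0, forall f g, J f -> J g -> J (f + g) & forall a f, J f -> J (a * f)].

Definition is_prime_ideal (p : set R) : Prop :=
  [/\ is_ideal p, ~ p 1 & forall f g, p (f * g) -> p f \/ p g].

Definition gen_ideal (S : set R) : set R :=
  [set f | exists (r : nat) (a g : 'I_r -> R),
     (forall i, S (g i)) /\ f = \sum_(i < r) a i * g i].

Definition ideal_exp (J : set R) (m : nat) : set R :=
  gen_ideal [set f | exists g : 'I_m -> R,
     (forall i, J (g i)) /\ f = \prod_(i < m) g i].

(* Ass(J) means Ass(R/J): the primes of the form (J : f). *)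
Definition Ass (J : set R) : set (set R) :=
  [set p | is_prime_ideal p /\ exists f, p = [set g | J (g * f)]].

Definition symbolic_power (J : set R) (m : nat) : set R :=
  \bigcap_(p in Ass J) ideal_exp p m.

End Ideals.

Section Alpha.
Variables (R : comNzRingType) (n : nat).

Definition has_form (J : set {mpoly R[n]}) (d : nat) : Prop :=
  exists f, [/\ J f, f != 0 & f \is d.-homog].

(* Junk value 0 when J contains no nonzero form. *)
Definition alpha (J : set {mpoly R[n]}) : nat :=
  xget 0%N [set d | has_form J d /\ forall e, has_form J e -> (d <= e)%N].

End Alpha.

Section Projective.
Variables (k : fieldType) (n : nat).

(* P^n as the set of lines of k^(n+1), so that equality of points is Leibniz
   equality. *)
Definition proj_space := {L : {vspace 'rV[k]_n.+1} | \dim L == 1%N}.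

Definition is_linear_form (l : {mpoly k[n.+1]}) : Prop :=
  l != 0 /\ l \is 1.-homog.

Definition hyperplane (l : {mpoly k[n.+1]}) : set proj_space :=
  [set P : proj_space |
     forall u : 'rV[k]_n.+1, u \in sval P -> l.@[fun i => u 0 i] = 0].

End Projective.

Definition steiner_system (V : finType) (B : {set {set V}}) (t n v : nat) :
    Prop :=
  [/\ #|V| = v,
      forall b, b \in B -> #|b| = n
    & forall T : {set V}, #|T| = t ->
        exists! b : {set V}, (b \in B) && (T \subset b)].

Section Configuration.
Variables (k : fieldType) (n v : nat).
Implicit Types (ell : 'I_v -> {mpoly k[n.+1]}) (B : {set {set 'I_v}}).

Definition meets_properly ell : Prop :=
  (forall s : {set 'I_v}, #|s| = n ->
     exists! P, (\bigcap_(i in [set` s]) hyperplane (ell i)) P) /\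
  (forall s : {set 'I_v}, #|s| = n.+1 ->
     \bigcap_(i in [set` s]) hyperplane (ell i) = set0).

Definition point_ideal ell (s : {set 'I_v}) : set {mpoly k[n.+1]} :=
  gen_ideal (ell @` [set` s]).

(* C_(n,v) \ B *)
Definition non_blocks B : {set {set 'I_v}} :=
  [set s : {set 'I_v} | #|s| == n]%SET :\: B.

Definition complement_ideal ell B : set {mpoly k[n.+1]} :=
  \bigcap_(s in [set` non_blocks B]) point_ideal ell s.

End Configuration.
Arguments non_blocks n {v} B.

(* Main.v *)
(* Write W_s for the flat cut out by the hyperplanes H_j, j in s, so that the
   point P_s is W_s when #|s| = n.

   Lower bound: a nonzero F in I^(h) vanishes to order h at P_s for every
   non-block s, and this forces h v <= n deg F (the Waldschmidt constant of I
   is at least v/n). On a line W_s of the arrangement lie v - n + 1 points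
   P_(j |: s), at most one of which comes from a block because two blocks share
   fewer than t <= n - 1 elements; so a form that is nonzero on W_s has degree
   at least h (v - n). On a larger flat W_s, either F is nonzero on some
   W_(j |: s), and induction on the dimension applies, or F is divisible on W_s
   by the product of all ell_j with j outside s. Dividing lowers the degree by
   v - #|s| and the orders at the points by n - #|s|, and descent on h applies.
   The numerical steps need v >= n + 2, which holds as soon as some n-subset is
   not a block.

   Upper bound: if m - 1 = q n + e with e < n, the product of the q-th power of
   all the ell_j with v - n + e + 1 further ell_j lies in I^(m), already for the
   star configuration. Hence n (alpha(I^(m)) + n - 1) <= (m + n - 1) v, and the
   two bounds combine. *)
From HB Require Import structures.
Require Import Defs.
From mathcomp Require Import all_boot all_order all_algebra.
From mathcomp Require Import boolp classical_sets.
From mathcomp Require Import mpoly zify ring.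

Set Implicit Arguments.
Unset Strict Implicit.
Unset Printing Implicit Defensive.

Import Order.TTheory GRing.Theory Num.Theory.

Local Open Scope ring_scope.

(** * Nonzero polynomials over an algebraically closed field have nonroots *)

Lemma poly_nonroot (k : closedFieldType) (p : {poly k}) :
  p != 0 -> exists x, p.[x] != 0.
Proof. by move=> /closed_nonrootP [x]; rewrite rootE; exists x. Qed.

Lemma poly_eq0_horner (k : closedFieldType) (p : {poly k}) :
  (forall x, p.[x] = 0) -> p = 0.
Proof.
move=> p0; apply/eqP/negPn/negP => /poly_nonroot [x].
by rewrite p0 eqxx.
Qed.

(** Guarantees that a nonzero coefficient of [p] survives in [muni p], which the induction on the
    number of variables relies on. *)
Lemma muni_coef (R : comNzRingType) (n : nat) (p : {mpoly R[n.+1]})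
    (m : 'X_{1..n.+1}) :
  ((muni p)`_(m ord_max))@_[multinom m (widen_ord (leqnSn n) i) | i < n] = p@_m.
Proof.
rewrite muniE coef_sum raddf_sum /= {3}(mpolyE p) raddf_sum /=.
apply: eq_bigr => m' _; rewrite coefZ coefXn mcoeffZ mcoeffX.
rewrite mulr_natr raddfMn /= mcoeffZ mcoeffX -[LHS]mulr_natr -mulrA.
rewrite -natrM mulnb.
congr (_ * _%:R); congr nat_of_bool.
apply/andP/eqP => [[/eqP mE /eqP/esym maxE]|->]; last by rewrite !eqxx.
apply/mnmP => i.
have [->//|ne_i] := eqVneq i ord_max.
have lt_in : (i < n)%N.
  have := ltn_ord i; rewrite ltnS leq_eqVlt => /orP[/eqP e|//].
  by rewrite -val_eqE /= e eqxx in ne_i.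
have /mnmP/(_ (Ordinal lt_in)) := mE; rewrite !mnmE.
by have -> : widen_ord (leqnSn n) (Ordinal lt_in) = i by apply: val_inj.
Qed.

Lemma meval_muni (R : comNzRingType) (n : nat) (p : {mpoly R[n.+1]})
    (x : 'I_n.+1 -> R) :
  p.@[x] = (map_poly (meval (x \o widen_ord (leqnSn n))) (muni p)).[x ord_max].
Proof.
rewrite {1}(mpolyE p) muniE !raddf_sum /= horner_sum; apply: eq_bigr => m _.
rewrite map_polyZ map_polyXn hornerZ hornerXn /= !mevalZ !mevalX -mulrA.
congr (_ * _); rewrite big_ord_recr /=; congr (_ * _).
by apply: eq_bigr => i _; rewrite mnmE.
Qed.

(** Induction on the number of variables: some coefficient in the last variable is nonzero at a
    point [y], and the univariate polynomial obtained at [y] has a nonroot [z]. *)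
Lemma mpoly_nonroot (k : closedFieldType) (n : nat) (p : {mpoly k[n]}) :
  p != 0 -> exists x : 'I_n -> k, p.@[x] != 0.
Proof.
elim: n p => [|n IHn] p p_neq0.
  exists (fun=> 0); have := p_neq0; rewrite (nvar0_mpolyC p) mevalC.
  by apply: contra => /eqP ->; rewrite mpolyC0.
have [m pm] : exists m, p@_m != 0.
  by exists (mlead p); rewrite -/(mleadc p) mleadc_eq0.
rewrite -muni_coef in pm.
have {}/IHn[y ypm] : (muni p)`_(m ord_max) != 0.
  by apply: contra pm => /eqP ->; rewrite mcoeff0.
have /poly_nonroot[z pz] : map_poly (meval y) (muni p) != 0.
  by apply: contra ypm => /eqP /(congr1 (coefp (m ord_max))) /=;
     rewrite coef_map coef0 => /= ->.
exists (fun i => if unlift ord_max i is Some j then y j else z).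
rewrite meval_muni unlift_none /=; congr (_.[_] != 0): pz.
apply: eq_map_poly => q; apply: meval_eq => i /=.
suff -> : widen_ord (leqnSn n) i = lift ord_max i by rewrite liftK.
by apply: val_inj; rewrite /= /bump leqNgt ltn_ord.
Qed.

Lemma dvdp_Xn_coef (k : fieldType) (h : nat) (p : {poly k}) :
  ('X^h %| p) <-> (forall i, (i < h)%N -> p`_i = 0).
Proof.
split=> [/dvdpP[q ->] i ih|p0]; first by rewrite coefMXn ih.
rewrite -(poly_take_drop h p) (_ : take_poly h p = 0) ?add0r ?dvdp_mulIr //.
by apply/polyP => i; rewrite coef_take_poly coef0; case: ifP => // /p0.
Qed.

(** * Restriction of polynomials to parametrised lines *)

Section Along.
Variables (k : fieldType) (n : nat).
Implicit Types (F G l : {mpoly k[n]}) (a b u : 'rV[k]_n).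

Definition ev F u := F.@[fun i => u 0 i].

(* [along a b F] is F(a + b X). For generic b its X-adic valuation is the order
   of vanishing of F at a. *)
Definition along a b : {mpoly k[n]} -> {poly k} :=
  mmap polyC (fun i => (a 0 i)%:P + b 0 i *: 'X).

HB.instance Definition _ a b := GRing.RMorphism.copy (along a b)
  (mmap polyC (fun i => (a 0 i)%:P + b 0 i *: 'X)).

Lemma along_horner a b F s : (along a b F).[s] = ev F (a + s *: b).
Proof.
rewrite /along /mmap horner_sum /ev mevalE; apply: eq_bigr => m _.
rewrite hornerCM /mmap1 horner_prod; congr (_ * _); apply: eq_bigr => i _.
by rewrite !hornerE !mxE mulrC.
Qed.

Lemma size_along a b F : (size (along a b F) <= msize F)%N.
Proof.
rewrite /along /mmap; apply: (leq_trans (size_sum _ _ _)).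
apply/bigmax_leqP_seq => m mF _; rewrite mul_polyC.
apply: (leq_trans (size_scale_leq _ _)).
apply: leq_trans (msize_mdeg_lt mF); rewrite mdegE /mmap1.
apply: (big_ind2 (fun (p : {poly k}) e => (size p <= e.+1)%N)) => //.
- by rewrite size_poly1.
- move=> p e q f pe qf; apply: (leq_trans (size_polyMleq _ _)).
  by rewrite -subn1 leq_subLR; lia.
- move=> i _; apply: (leq_trans (size_poly_exp_leq _ _)); rewrite ltnS.
  set q := (X in size X); have : (size q <= 2)%N.
    rewrite /q (leq_trans (size_polyD _ _)) // geq_max.
    rewrite (leq_trans (size_polyC_leq1 _)) //=.
    by rewrite (leq_trans (size_scale_leq _ _)) ?size_polyX.
  by move: (size q) => -[|[|[|//]]] _ /=; rewrite ?mul0n ?mul1n.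
Qed.

Lemma along_shift a b c F :
  along a b F \Po (c%:P + 'X) = along (a + c *: b) b F.
Proof.
rewrite /along /mmap raddf_sum; apply: eq_bigr => m _ /=.
rewrite comp_polyM comp_polyC /mmap1 rmorph_prod /=; congr (_ * _).
apply: eq_bigr => i _; rewrite rmorphXn /=; congr (_ ^+ _).
rewrite comp_polyD comp_polyC comp_polyZ comp_polyX !mxE scalerDr polyCD addrA.
by congr (_ + _ + _); rewrite -mul_polyC -polyCM mulrC.
Qed.

Lemma along_linear l a b :
  l \is 1.-homog -> along a b l = (ev l a)%:P + ev l b *: 'X.
Proof.
move/dhomogP => hl; rewrite /along /mmap /ev !mevalE.
rewrite rmorph_sum scaler_suml -big_split /=; apply: eq_big_seq => m /hl.
move/eqP/mdeg1P => [i /eqP ->].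
have prodU (g : 'I_n -> k) : \prod_j g j ^+ U_(i)%MM j = g i.
  by rewrite -[LHS](mevalX g) mevalXU.
by rewrite mmap1U !prodU polyCM mulrDr -!mul_polyC polyCM mulrA.
Qed.

Lemma ev_linearP l a b s :
  l \is 1.-homog -> ev l (a + s *: b) = ev l a + s * ev l b.
Proof. by move=> hl; rewrite -along_horner along_linear // !hornerE mulrC. Qed.

Lemma ev_linearZ l b s : l \is 1.-homog -> ev l (s *: b) = s * ev l b.
Proof.
move=> hl; have := ev_linearP 0 b s hl; have := ev_linearP 0 0 1 hl.
rewrite mul1r scaler0 !add0r => /eqP.
by rewrite -subr_eq0 opprD addNKr oppr_eq0 => /eqP ->; rewrite add0r.
Qed.

End Along.

(** Each coefficient of F(a + X (b + s c)) is a polynomial in s. Below degree h its product with [q]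
    vanishes everywhere, so it is zero, in particular at s = 0. *)
Lemma along_dense (k : closedFieldType) (n h : nat) (F : {mpoly k[n]})
    (a b c : 'rV[k]_n) (q : {poly k}) : q != 0 ->
  (forall s, q.[s] != 0 -> 'X^h %| along a (b + s *: c) F) ->
  'X^h %| along a b F.
Proof.
move=> q0 dvdF; apply/dvdp_Xn_coef => i ih.
(* [P] is F(a + X (b + s c)) as a polynomial in X with coefficients in k[s]. *)
pose P : {poly {poly k}} := mmap (polyC \o polyC)
  (fun i => (a 0 i)%:P%:P + ((b 0 i)%:P + c 0 i *: 'X) *: 'X) F.
have PE s : map_poly (horner_eval s) P = along a (b + s *: c) F.
  pose psi : {rmorphism {poly {poly k}} -> {poly k}} :=
    map_poly (horner_eval s).
  have psiC r : psi r%:P = r.[s]%:P by rewrite /psi /= map_polyC.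
  have psiX : psi 'X = 'X by rewrite /psi /= map_polyX.
  rewrite -[LHS]/(psi P) /P /mmap rmorph_sum; apply: eq_bigr => m _.
  rewrite rmorphM /comp psiC hornerC /mmap1 rmorph_prod; congr (_ * _).
  apply: eq_bigr => j _; rewrite rmorphXn; congr (_ ^+ _).
  rewrite rmorphD -mul_polyC rmorphM !psiC psiX !hornerE !mxE [s * _]mulrC.
  by rewrite mul_polyC.
have coefPE s : (along a (b + s *: c) F)`_i = (P`_i).[s].
  by rewrite -PE coef_map.
suff Pi0 : P`_i = 0 by rewrite -[b]addr0 -(scale0r c) coefPE Pi0 horner0.
have /eqP : q * P`_i = 0.
  apply: poly_eq0_horner => s; rewrite hornerM.
  have [->|qs] := eqVneq q.[s] 0; first by rewrite mul0r.
  by move/dvdF: qs => /dvdp_Xn_coef/(_ i ih); rewrite coefPE => ->;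
     rewrite mulr0.
by rewrite mulf_eq0 (negbTE q0) => /eqP.
Qed.

(** * Substitution modulo an ideal and division by a linear form *)

Lemma comp_mpoly_congr (R : comNzRingType) (n p : nat) (J : set {mpoly R[p]})
    (F : {mpoly R[n]}) (x y : n.-tuple {mpoly R[p]}) :
  is_ideal J -> (forall i, J (tnth x i - tnth y i)) ->
  J ((F \mPo x) - (F \mPo y)).
Proof.
move=> [J0 JD JM] Jxy; rewrite !comp_mpolyE.
have JMM f g f' g' : J (f - f') -> J (g - g') -> J (f * g - f' * g').
  move=> Jf Jg.
  have -> : f * g - f' * g' = g * (f - f') + f' * (g - g') by ring.
  by apply: JD; apply: JM.
apply: (big_ind2 (fun f g => J (f - g))); first by rewrite subr0.
  by move=> f f' g g' Jf Jg; rewrite opprD addrACA; apply: JD.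
move=> m _; rewrite -scalerBr -mul_mpolyC; apply: JM.
apply: (big_ind2 (fun f g => J (f - g))) => [|*|i _].
- by rewrite subrr.
- exact: JMM.
- by elim: (m i) => [|e IHe]; rewrite ?expr0 ?subrr // !exprS; apply: JMM.
Qed.

Lemma msize_comp_mpoly (k : idomainType) (n p : nat) (F : {mpoly k[n]})
    (x : n.-tuple {mpoly k[p]}) :
  (forall i, msize (tnth x i) <= 2)%N -> (msize (F \mPo x) <= msize F)%N.
Proof.
move=> sx; rewrite comp_mpolyE; apply: (leq_trans (msize_sum _ _ _)).
apply/bigmax_leqP_seq => m mF _.
apply: (leq_trans (msizeZ_le _ _)).
apply: leq_trans (msize_mdeg_lt mF); rewrite mdegE.
have sM (f g : {mpoly k[p]}) d e : (msize f <= d.+1 -> msize g <= e.+1 ->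
    msize (f * g) <= (d + e).+1)%N.
  have [->|f0] := eqVneq f 0; first by rewrite mul0r msize0.
  have [->|g0] := eqVneq g 0; first by rewrite mulr0 msize0.
  by move=> fd ge; rewrite msizeM //; lia.
apply: (big_ind2 (fun (f : {mpoly k[p]}) e => (msize f <= e.+1)%N)) => //.
- by rewrite msize1.
- by move=> f d g e; apply: sM.
- move=> i _; elim: (m i) => [|e IHe]; first by rewrite expr0 msize1.
  by rewrite exprS; apply: (sM _ _ 1%N).
Qed.

(* F and its composite with the projection along u0 onto the hyperplane l = 0
   agree modulo l. *)
Lemma linear_division (k : fieldType) (n : nat) (l F : {mpoly k[n]})
    (u0 : 'rV[k]_n) : l \is 1.-homog -> ev l u0 = 1 ->
  exists G, (msize G <= (msize F).-1)%N /\
    forall u, ev F u = ev l u * ev G u + ev F (u - ev l u *: u0).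
Proof.
move=> hl lu0.
have l0 : l != 0.
  apply/eqP => l0; move: lu0; rewrite l0 /ev meval0 => /eqP.
  by rewrite eq_sym oner_eq0.
have sl : msize l = 2%N.
  have := dhomog_uniq l0 hl (dhomog_msize hl).
  by case: (msize l) => [//|[//|m [->]]].
pose x := [tuple 'X_i : {mpoly k[n]} | i < n].
pose y := [tuple ('X_i - (u0 0 i) *: l) : {mpoly k[n]} | i < n].
have [] := @comp_mpoly_congr k n n [set f | exists G, f = l * G]%classic F x y.
- split=> [|_ _ [f ->] [g ->]|a _ [f ->]]; first by exists 0; rewrite mulr0.
    by exists (f + g); rewrite mulrDr.
  by exists (a * f); rewrite mulrCA.
- move=> i; exists (u0 0 i)%:MP; rewrite !tnth_mktuple opprB addrC subrK.
  by rewrite mulrC mul_mpolyC.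
move=> G; rewrite /x comp_mpoly_id => FE; exists G; split; last first.
  move=> u; rewrite -mevalM [X in _ = _ + X](_ : _ = ev (F \mPo y) u).
    by rewrite -mevalD -FE subrK.
  rewrite /ev comp_mpoly_meval; apply: meval_eq => i.
  by rewrite tnth_mktuple mevalB mevalXU mevalZ !mxE mulrC.
have [->|G0] := eqVneq G 0; first by rewrite msize0.
have : (msize (l * G) <= msize F)%N.
  rewrite -FE (leq_trans (msizeD_le _ _)) // geq_max leqnn msizeN /=.
  apply: msize_comp_mpoly => i; rewrite tnth_mktuple.
  rewrite (leq_trans (msizeD_le _ _)) // geq_max msizeN msizeX mdeg1 leqnn /=.
  by rewrite (leq_trans (msizeZ_le _ _)) ?sl.
rewrite msizeM // sl; move: (msize G) (msize F) => g f; lia.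
Qed.

(** * Subsets of given size and products of coprime divisors *)

Lemma subset_of_card (T : finType) (A C : {set T}) (m : nat) :
  A \subset C -> (#|A| <= m <= #|C|)%N ->
  exists D : {set T}, [/\ A \subset D, D \subset C & #|D| = m].
Proof.
move=> AC /andP[Am mC]; pose s := take (m - #|A|) (enum (C :\: A)).
have us : uniq s by rewrite take_uniq ?enum_uniq.
have sD x : x \in s -> x \in C :\: A by move=> /mem_take; rewrite mem_enum.
have cs : #|[set x in s]| = (m - #|A|)%N.
  rewrite cardsE (card_uniqP us) size_takel // -cardE cardsD.
  by rewrite (finset.setIidPr AC) leq_sub2r.
exists (A :|: [set x in s]); split; first exact: finset.subsetUl.
  rewrite finset.subUset AC; apply/fintype.subsetP => x; rewrite inE => /sD.
  by rewrite inE => /andP[].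
rewrite cardsU cs (_ : A :&: _ = finset.set0) ?cards0; first by lia.
apply/setP => x; rewrite !inE; apply/negP => /andP[xA /sD].
by rewrite inE xA.
Qed.

Lemma dvdp_prod_coprime (k : fieldType) (I : eqType) (r : seq I)
    (P : I -> {poly k}) (q : {poly k}) :
  uniq r -> {in r &, forall i j, i != j -> coprimep (P i) (P j)} ->
  {in r, forall i, P i %| q} -> \prod_(i <- r) P i %| q.
Proof.
elim: r => [|i r IHr] /=; first by rewrite big_nil dvd1p.
case/andP=> ir ur cop dvd; rewrite big_cons Gauss_dvdp.
  rewrite dvd ?mem_head // IHr // => [j l jr lr|j jr].
    by apply: cop; rewrite inE ?jr ?lr orbT.
  by apply: dvd; rewrite inE jr orbT.
rewrite big_seq; apply: (big_ind (coprimep (P i))); first exact: coprimep1.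
  by move=> f g cf cg; rewrite coprimepMr cf.
move=> j jr; apply: cop; rewrite ?mem_head ?inE ?jr ?orbT //.
by apply: contraNneq ir => ->.
Qed.

(** * Flats of the arrangement and the lower bound on degrees *)

Section Arrangement.
Variables (k : closedFieldType) (n v : nat) (ell : 'I_v -> {mpoly k[n.+1]}).
Implicit Types (s t : {set 'I_v}) (u a b : 'rV[k]_n.+1) (F G : {mpoly k[n.+1]}).

Definition flat s u : Prop := forall i, i \in s -> ev (ell i) u = 0.

Definition nonvanishing s F : Prop := exists2 u, flat s u & ev F u != 0.

Definition generic_poly s := \prod_(j | j \notin s) ell j.

Hypothesis ell_homog : forall j, ell j \is 1.-homog.
Hypothesis flat_point : forall s, #|s| = n -> exists2 a, a != 0 & flat s a.
Hypothesis flat_eq0 : forall s u, #|s| = n.+1 -> flat s u -> u = 0.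
Hypothesis n_gt1 : (1 < n)%N.
Hypothesis v_big : (n.+1 < v)%N.

Lemma flatD s a b x : flat s a -> flat s b -> flat s (a + x *: b).
Proof.
by move=> sa sb i si; rewrite ev_linearP // sa // sb // mulr0 addr0.
Qed.

Lemma flatB s a b : flat s a -> flat s b -> flat s (a - b).
Proof. by rewrite -scaleN1r; apply: flatD. Qed.

Lemma flatS s t u : s \subset t -> flat t u -> flat s u.
Proof. by move=> /fintype.subsetP st tu i /st; apply: tu. Qed.

Lemma flatU1 s j u : ev (ell j) u = 0 -> flat s u -> flat (j |: s) u.
Proof. by move=> ju su i /finset.setU1P[->|/su]. Qed.

(* A flat is irreducible: restrict F and G to the line through two witnesses. *)
Lemma nonvanishingM s F G :
  nonvanishing s F -> nonvanishing s G -> nonvanishing s (F * G).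
Proof.
move=> [x sx Fx] [y sy Gy].
have /poly_nonroot[z] : along x (y - x) F * along x (y - x) G != 0.
  rewrite mulf_neq0 //.
    by apply: contra Fx => /eqP /(congr1 (horner^~ 0));
       rewrite along_horner scale0r addr0 horner0 => /eqP.
  by apply: contra Gy => /eqP /(congr1 (horner^~ 1));
     rewrite along_horner scale1r addrC subrK horner0 => /eqP.
rewrite -rmorphM along_horner; exists (x + z *: (y - x)) => //.
by apply: flatD => //; apply: flatB.
Qed.

(** Extend [s] to an n-subset avoiding [j]: its point cannot lie on H_j, since n + 1 hyperplanes
    have no common point. *)
Lemma nonvanishing_ell s j : (#|s| < n)%N -> j \notin s ->
  nonvanishing s (ell j).
Proof.
move=> sn js; have [] := @subset_of_card _ s (~: [set j]) n.
- by rewrite finset.subsetC finset.sub1set inE.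
- by rewrite ltnW //= cardsCs finset.setCK cards1 card_ord; move: v_big; lia.
move=> t [st tj tn]; have [a a0 ta] := flat_point tn.
exists a; first exact: flatS ta.
apply: contra a0 => /eqP ja; apply/eqP/(@flat_eq0 (j |: t)); last exact: flatU1.
have jt : j \notin t.
  by apply/negP => /(fintype.subsetP tj); rewrite !inE eqxx.
by rewrite cardsU1 jt tn.
Qed.

Lemma nonvanishing1 s : nonvanishing s 1.
Proof.
exists 0; last by rewrite /ev meval1 oner_eq0.
by move=> i _; rewrite -[0](scale0r 0) ev_linearZ // mul0r.
Qed.

Lemma nonvanishing_prod s (r : seq 'I_v) : (#|s| < n)%N ->
  {in r, forall j, j \notin s} -> nonvanishing s (\prod_(j <- r) ell j).
Proof.
move=> sn rs; rewrite big_seq.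
apply: (big_ind (nonvanishing s)) => [|F G|j /rs js].
- exact: nonvanishing1.
- exact: nonvanishingM.
- exact: nonvanishing_ell.
Qed.

Lemma generic_polyE s : generic_poly s = \prod_(j <- enum (~: s)) ell j.
Proof. by rewrite big_enum; apply: eq_bigl => j; rewrite !inE. Qed.

Lemma nonvanishing_generic s : (#|s| < n)%N -> nonvanishing s (generic_poly s).
Proof.
move=> sn; rewrite generic_polyE; apply: nonvanishing_prod => // j.
by rewrite mem_enum inE.
Qed.

Lemma generic_poly_neq0 s u j :
  ev (generic_poly s) u != 0 -> j \notin s -> ev (ell j) u != 0.
Proof.
by rewrite /ev rmorph_prod /= => /prodf_neq0 + js => /(_ j js).
Qed.

Variable B : {set {set 'I_v}}.
Hypothesis B_sparse : forall s i j, #|s| = n.-1 -> i \notin s -> j \notin s ->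
  i |: s \in B -> j |: s \in B -> i = j.

(** Only directions [b] inside W_s are tested, so this is the order at P_t of the restriction of F
    to W_s. *)
Definition order_at_points s (h : nat) F : Prop := forall t a b,
  #|t| = n -> s \subset t -> t \notin B -> flat t a -> a != 0 -> flat s b ->
  'X^h %| along a b F.

Lemma line_bound s h F : #|s|.+1 = n -> nonvanishing s F ->
  order_at_points s h F -> (h * (v - n) <= (msize F).-1)%N.
Proof.
move=> sn nvF ordF; have s_lt : (#|s| < n)%N by rewrite sn.
(* A point of the line where F is nonzero and which lies on no further hyperplane. *)
have [x sx] := nonvanishingM nvF (nonvanishing_generic s_lt).
rewrite /ev mevalM mulf_eq0 negb_or -!/(ev _ _) => /andP[Fx Qx].
have [j0 j0s] : exists j0, j0 \notin s.
  have /card_gt0P[j] : (0 < #|~: s|)%N.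
    by rewrite cardsCs finset.setCK card_ord; lia.
  by rewrite inE; exists j.
have [a0 a0_neq0 sa0] : exists2 a, a != 0 & flat (j0 |: s) a.
  by apply: flat_point; rewrite cardsU1 j0s.
have sa0' : flat s a0 by apply: flatS sa0; apply: finset.subsetUr.
(* The factor X forces z to be nonzero, so that w = x + z a0 is independent of x; the other factor
   keeps w off every H_j with j outside [s], so that the r_j below are defined. *)
have [z] : exists z, ('X * along x a0 (generic_poly s)).[z] != 0.
  apply: poly_nonroot; rewrite mulf_neq0 ?polyX_eq0 //.
  by apply: contra Qx => /eqP /(congr1 (horner^~ 0));
     rewrite along_horner scale0r addr0 horner0 => /eqP.
rewrite hornerM hornerX along_horner mulf_eq0 negb_or.
set w := x + z *: a0 => /andP[z0 Qw]; have sw : flat s w by exact: flatD.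
have xj j := generic_poly_neq0 Qx (j := j).
have wj j := generic_poly_neq0 Qw (j := j).
(* The affine line x + r w of W_s meets H_j at r = r_j, in a representative of
   the point P_(j |: s); so r_j is a root of order h of F(x + X w). *)
pose r j := - (ev (ell j) x / ev (ell j) w).
have flat_r j : j \notin s -> flat (j |: s) (x + r j *: w).
  move=> js; apply: flatU1; last exact: flatD.
  by rewrite ev_linearP // /r mulNr divfK ?subrr // wj.
(* If x + r_j w = 0, applying [ell j0], which kills a0, gives r_j = -1, and then z a0 = 0. *)
have r_neq0 j : x + r j *: w != 0.
  apply/eqP => e0; have := congr1 (ev (ell j0)) e0.
  rewrite ev_linearP // {1}/w ev_linearP // sa0 ?finset.setU11 // mulr0 addr0.
  rewrite -[0](scale0r 0) ev_linearZ // mul0r -[X in X + _]mul1r -mulrDl.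
  move/eqP; rewrite mulf_eq0 (negbTE (xj _ j0s)) orbF => /eqP rE.
  have rjE : r j = -1 by apply/eqP; rewrite -addr_eq0 addrC rE.
  move: e0; rewrite rjE scaleN1r /w opprD addNKr => /eqP.
  by rewrite oppr_eq0 scaler_eq0 (negbTE z0) (negbTE a0_neq0).
(* Otherwise a nonzero vector would lie on n + 1 hyperplanes. *)
have r_inj i j : i \notin s -> j \notin s -> r i = r j -> i = j.
  move=> si sj rij; apply/eqP/negPn/negP => ij.
  have /negP[] := r_neq0 i; apply/eqP/(@flat_eq0 (j |: (i |: s))).
    by rewrite !cardsU1 !inE si eq_sym negb_or ij sj; lia.
  apply: flatU1; last exact: flat_r.
  by rewrite rij; apply: (flat_r j) => //; rewrite finset.setU11.
pose q := along x w F.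
have q_neq0 : q != 0.
  by apply: contra Fx => /eqP /(congr1 (horner^~ 0));
     rewrite along_horner scale0r addr0 horner0 => /eqP.
pose J := [set j | (j \notin s) && (j |: s \notin B)].
have cardJ : (v - n <= #|J|)%N.
  pose K := [set j | (j \notin s) && (j |: s \in B)].
  have cK : (#|K| <= 1)%N.
    apply/card_le1_eqP => i j; rewrite !inE => /andP[si Bi] /andP[sj Bj].
    by apply: (@B_sparse s); rewrite // -sn.
  have : #|~: s| = (#|K| + #|J|)%N.
    rewrite -cardsUI (_ : K :&: J = finset.set0) ?cards0 ?addn0.
      congr #|pred_of_set _|; apply/setP => j; rewrite !inE.
      by case: (j \in s) => //=; case: (_ \in B).
    by apply/setP => j; rewrite !inE; case: (j \in s) => //=; case: (_ \in B).
  rewrite cardsCs finset.setCK card_ord; lia.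
have : \prod_(j <- enum J) ('X - (r j)%:P) ^+ h %| q.
  apply: dvdp_prod_coprime; first exact: enum_uniq.
    move=> i j; rewrite !mem_enum !inE => /andP[si _] /andP[sj _] ij.
    rewrite coprimep_expl // coprimep_expr // coprimep_XsubC root_XsubC.
    by apply: contra ij => /eqP /r_inj -> .
  move=> j; rewrite mem_enum inE => /andP[sj Bj].
  have := ordF (j |: s) (x + r j *: w) w.
  rewrite cardsU1 sj add1n sn finset.subsetUr.
  move=> /(_ erefl isT Bj (flat_r j sj) (r_neq0 j) sw).
  (* Divisibility is known with the parameter recentred at r_j; substituting X - r_j undoes the
     shift. *)
  rewrite -along_shift => /dvdpP[p /(congr1 (comp_poly ('X - (r j)%:P)))].
  rewrite -comp_polyA comp_polyD comp_polyC comp_polyX addrC subrK comp_polyXr.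
  by rewrite comp_polyM rmorphXn /= comp_polyX => qE; rewrite /q qE dvdp_mulIr.
move/dvdp_leq => /(_ q_neq0) /leq_trans /(_ (size_along _ _ _)).
have -> : size (\prod_(j <- enum J) ('X - (r j)%:P) ^+ h) = (#|J| * h).+1.
  rewrite size_prod_seq; last first.
    by move=> j _; rewrite expf_neq0 // polyXsubC_eq0.
  rewrite (eq_bigr (fun=> h.+1)); last by move=> j _; rewrite size_exp_XsubC.
  rewrite big_const_seq count_predT -cardE iter_addn_0.
  move: #|J| => J'. nia.
move: (msize F) => f; nia.
Qed.

(** One factor is divided out at a time. The quotient so far still vanishes on W_(j |: s): that flat
    is irreducible, and since #|s| + 1 < n the earlier factors do not vanish identically on it. *)
Lemma divide_out s (r : seq 'I_v) F : (#|s|.+1 < n)%N -> uniq r ->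
    {in r, forall j, j \notin s} ->
    (forall j u, j \notin s -> flat (j |: s) u -> ev F u = 0) ->
  exists G, (msize G <= msize F - size r)%N /\
    forall u, flat s u -> ev F u = ev (\prod_(j <- r) ell j) u * ev G u.
Proof.
move=> sn + + F0; elim: r => [|j r IHr] /=.
  move=> _ _; exists F; rewrite subn0; split=> // u _.
  by rewrite big_nil /ev meval1 mul1r.
case/andP=> jr ur rs; have js : j \notin s by rewrite rs ?mem_head.
have {}rs : {in r, forall j, j \notin s}.
  by move=> i ir; rewrite rs // inE ir orbT.
have [//|//|G [Gsize GE]] := IHr.
have jsn : (#|j |: s| < n)%N by rewrite cardsU1 js.
have G0 u : flat (j |: s) u -> ev G u = 0.
  move=> ju; apply/eqP/negPn/negP => Gu.
  have nvr : nonvanishing (j |: s) (\prod_(i <- r) ell i).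
    apply: nonvanishing_prod => // i ir; rewrite !inE negb_or rs // andbT.
    by apply: contraNneq jr => <-.
  have nvG : nonvanishing (j |: s) G by exists u.
  have [x jx] := nonvanishingM nvr nvG.
  rewrite /ev mevalM -!/(ev _ _) -GE ?(F0 j x) ?eqxx //.
  by apply: flatS jx; apply: finset.subsetUr.
have [c sc jc] := nonvanishing_ell (ltnW sn) js.
(* The projection along [c1] sends W_s into W_(j |: s), where G vanishes, so the remainder of the
   division by [ell j] disappears on W_s. *)
pose c1 := (ev (ell j) c)^-1 *: c.
have jc1 : ev (ell j) c1 = 1 by rewrite ev_linearZ // mulVf.
have sc1 : flat s c1 by move=> i si; rewrite ev_linearZ // (sc i) // mulr0.
have [G' [G'size G'E]] := linear_division G (ell_homog j) jc1.
exists G'; split.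
  by move: G'size Gsize; move: (msize _) (msize _) (msize _); lia.
move=> u su; rewrite GE // G'E (G0 (u - _)) ?addr0; last first.
  apply: flatU1; rewrite -scaleNr; last exact: flatD.
  by rewrite ev_linearP // jc1 mulr1 subrr.
by rewrite big_cons /ev mevalM; ring.
Qed.

(** Exactly the factors with index in t minus s vanish at [a]. Each contributes one X with a
    constant that is nonzero by the choice of [b]; the others form a unit at 0. *)
Lemma along_generic_poly s t a b :
    #|t| = n -> s \subset t -> flat t a -> a != 0 ->
    ev (generic_poly s) b != 0 ->
  exists2 U : {poly k}, U.[0] != 0 &
    along a b (generic_poly s) = 'X^(n - #|s|) * U.
Proof.
move=> tn st ta a0 Qb.
rewrite rmorph_prod /= (bigID (mem t)) /=.
pose U1 := \prod_(j | (j \notin s) && (j \in t)) (ev (ell j) b)%:P.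
pose U2 := \prod_(j | (j \notin s) && (j \notin t)) along a b (ell j).
exists (U1 * U2).
  rewrite hornerM mulf_neq0 // horner_prod; apply/prodf_neq0 => j /andP[js jt].
    by rewrite hornerC (generic_poly_neq0 Qb).
  rewrite along_horner scale0r addr0; apply: contra a0 => /eqP ja.
  by apply/eqP/(@flat_eq0 (j |: t)); [rewrite cardsU1 jt tn | apply: flatU1].
rewrite mulrA; congr (_ * _).
rewrite (eq_bigr (fun j => 'X * (ev (ell j) b)%:P)); last first.
  by move=> j /andP[_ jt]; rewrite along_linear // ta // add0r -mul_polyC mulrC.
rewrite big_split /= prodr_const; congr ('X^_ * _).
rewrite -[RHS](_ : #|t :\: s| = _)%N.
  by apply: eq_card => j; rewrite !inE.
by rewrite cardsD (finset.setIidPr st) tn.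
Qed.

(** The power of X can be cancelled exactly in directions on which no [ell j], j outside [s],
    vanishes. [along_dense] extends the result to every [b] through the line joining it to a generic
    [y]. *)
Lemma order_divide s h F G : (#|s| < n)%N -> order_at_points s h F ->
  (forall u, flat s u -> ev F u = ev (generic_poly s) u * ev G u) ->
  order_at_points s (h - (n - #|s|)) G.
Proof.
move=> sn ordF FE t a b tn st tB ta a0 sb.
have sa : flat s a by exact: flatS ta.
have [y sy Qy] := nonvanishing_generic sn.
apply: (@along_dense _ _ _ _ _ _ (y - b) (along b (y - b) (generic_poly s))).
  apply: contra Qy => /eqP /(congr1 (horner^~ 1)).
  by rewrite along_horner scale1r addrC subrK horner0 => /eqP.
move=> z; rewrite along_horner; set c := b + _ => Qc.
have sc : flat s c.
  by apply: flatD => //; apply: flatB.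
have [U U0 QE] := along_generic_poly tn st ta a0 Qc.
have alongF : along a c F = along a c (generic_poly s) * along a c G.
  apply/eqP; rewrite -subr_eq0; apply/eqP/poly_eq0_horner => x.
  rewrite hornerD hornerN hornerM !along_horner FE ?subrr //; exact: flatD.
(* Subtraction is truncated: in the first case the claimed order is 0. *)
have [hN|Nh] := leqP h (n - #|s|).
  by rewrite (eqP (_ : h - _ == 0)%N) ?subn_eq0 // expr0 dvd1p.
have := ordF t a c tn st tB ta a0 sc.
rewrite alongF QE -{1}(subnKC (ltnW Nh)) exprD -mulrA.
rewrite dvdp_mul2l ?expf_neq0 ?polyX_eq0 //.
rewrite Gauss_dvdpr // coprimep_expl // coprimep_sym coprimepX.
by rewrite rootE.
Qed.

(** Induction on the dimension N of W_s. For N = 1 the factor is v - n and not v - #|s| = v - n + 1,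
    because a block may remove one point of the line. *)
Lemma flat_bound s N h F : (#|s| + N = n)%N -> (0 < N)%N -> nonvanishing s F ->
  order_at_points s h F ->
  (if N == 1 then h * (v - n) <= (msize F).-1
   else h * (v - #|s|) <= N * (msize F).-1)%N.
Proof.
elim: N s h F => [//|N IHN] s h F sN _ nvF.
have [N0 ordF|N0] := eqVneq N.+1 1%N.
  by apply: (line_bound (s := s)) => //; lia.
(* For a fixed flat, strong induction on the order h drives the descent by division. *)
elim/ltn_ind: h F nvF => h IHh F nvF ordF.
have sn : (#|s| < n)%N by lia.
have [[j js nvj]|nonv] :=
  pselect (exists2 j, j \notin s & nonvanishing (j |: s) F).
  have ordj : order_at_points (j |: s) h F.
    move=> t a b tn jst tB ta a0 jb.
    have sjs : s \subset j |: s by apply: finset.subsetUr.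
    apply: (ordF t) => //; last exact: flatS jb.
    exact: (fintype.subset_trans sjs).
  have cjs : #|j |: s| = #|s|.+1 by rewrite cardsU1 js.
  have := IHN (j |: s) h F _ _ nvj ordj.
  rewrite cjs => /(_ ltac:(lia) ltac:(lia)).
  have vs : (#|s| + N.+3 <= v)%N by lia.
  have N1 : (0 < N)%N by lia.
  move: (msize F).-1 => d; case: eqP => [N1E|N1E].
    (* Passing from a line to a plane: v - n + 2 <= 2 (v - n), because v >= n + 2. *)
    by subst N; rewrite -sN; nia.
  have -> : (v - #|s| = (v - #|s|.+1).+1)%N by lia.
  (* With w = v - #|s| - 1, the inequalities h w <= N d and N <= w give N h (w + 1) <= (N + 1) h w
     <= N (N + 1) d. *)
  have : (N <= v - #|s|.+1)%N by lia.
  move: (v - #|s|.+1)%N => w Nw hw.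
  rewrite -(leq_pmul2l N1); nia.
have F0 j u : j \notin s -> flat (j |: s) u -> ev F u = 0.
  move=> js ju; apply/eqP/negPn/negP => Fu; apply: nonv.
  by exists j => //; exists u.
have [||||G [Gsize GE]] := @divide_out s (enum (~: s)) F => //.
- by lia.
- exact: enum_uniq.
- by move=> j; rewrite mem_enum inE.
rewrite -generic_polyE in GE.
have nvG : nonvanishing s G.
  have [u su Fu] := nvF; exists u => //.
  by apply: contra Fu => /eqP Gu; rewrite GE // Gu mulr0.
have G1 : (0 < msize G)%N.
  have [u su Gu] := nvG; rewrite lt0n msize_poly_eq0.
  by apply: contra Gu => /eqP ->; rewrite /ev meval0.
have ordG := order_divide sn ordF GE.
rewrite -cardE cardsCs finset.setCK card_ord in Gsize.
have [h0|h0] := posnP h; first by rewrite h0.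
have := IHh (h - (n - #|s|))%N _ G nvG ordG.
move: Gsize G1; rewrite (_ : n - #|s| = N.+1)%N; last by lia.
move: (v - #|s|)%N (msize F) (msize G) => w f g fg g0 /(_ ltac:(lia)).
(* For h <= N + 1 the degree of the divided product already suffices; otherwise the induction
   hypothesis for G is used. *)
have [hN _|hN] := leqP h N.+1.
  by apply: leq_mul => //; lia.
rewrite mulnBl leq_subLR => hw; apply: (leq_trans hw).
rewrite -mulnDr leq_mul2l; lia.
Qed.

Lemma order_bound h F : F != 0 -> order_at_points finset.set0 h F ->
  (h * v <= n * (msize F).-1)%N.
Proof.
move=> F0 ordF.
have nvF : nonvanishing finset.set0 F.
  have [x Fx] := mpoly_nonroot F0.
  exists (\row_i x i); first by move=> i; rewrite inE.
  by rewrite /ev (meval_eq (v2 := x)) // => i; rewrite mxE.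
have := @flat_bound finset.set0 n h F; rewrite cards0 subn0.
by move=> /(_ erefl ltac:(lia) nvF ordF); rewrite gtn_eqF.
Qed.

End Arrangement.

(** * Generated ideals and their powers *)

Section IdealPowers.
Variable R : comNzRingType.
Implicit Types (S J K : set R) (f g x : R).
Local Open Scope classical_set_scope.

Lemma is_ideal_gen S : is_ideal (gen_ideal S).
Proof.
split=> [|f g|a f].
- by exists 0%N, (fun=> 0), (fun=> 0); split; [case | rewrite big_ord0].
- move=> [r [a [x [Sx ->]]]] [r' [a' [x' [Sx' ->]]]].
  pose h (T : Type) (y : 'I_r -> T) (y' : 'I_r' -> T) (i : 'I_(r + r')) :=
    match fintype.split i with inl j => y j | inr j => y' j end.
  exists (r + r')%N, (h _ a a'), (h _ x x'); split.
    by move=> i; rewrite /h; case: fintype.split.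
  rewrite big_split_ord; congr (_ + _); apply: eq_bigr => i _; rewrite /h.
    by rewrite (unsplitK (inl _ i)).
  by rewrite (unsplitK (inr _ i)).
- move=> [r [b [x [Sx ->]]]]; exists r, (fun i => a * b i), x; split=> //.
  by rewrite mulr_sumr; apply: eq_bigr => i _; rewrite mulrA.
Qed.

Lemma sub_gen_ideal S : S `<=` gen_ideal S.
Proof.
move=> f Sf; exists 1%N, (fun=> 1), (fun=> f); split=> //.
by rewrite big_ord1 mul1r.
Qed.

Lemma gen_ideal_min S K : is_ideal K -> S `<=` K -> gen_ideal S `<=` K.
Proof.
move=> [K0 KD KM] SK _ [r [a [x [Sx ->]]]].
by apply: (big_ind K) => // i _; apply/KM/SK.
Qed.

Lemma is_ideal_exp J m : is_ideal (ideal_exp J m).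
Proof. exact: is_ideal_gen. Qed.

Lemma ideal_exp_min J K m : is_ideal K ->
  (forall g : 'I_m -> R, (forall i, J (g i)) -> K (\prod_(i < m) g i)) ->
  ideal_exp J m `<=` K.
Proof.
by move=> iK JK; apply: gen_ideal_min => // _ [g [Jg ->]]; apply: JK.
Qed.

Lemma ideal_expS J K m : J `<=` K -> ideal_exp J m `<=` ideal_exp K m.
Proof.
move=> JK; apply: ideal_exp_min => [|g Jg]; first exact: is_ideal_exp.
by apply: sub_gen_ideal; exists g; split=> // i; apply/JK/Jg.
Qed.

Lemma ideal_exp_mull J m x f :
  J x -> ideal_exp J m f -> ideal_exp J m.+1 (x * f).
Proof.
move=> Jx; have [E0 ED EM] := is_ideal_exp J m.+1.
apply: (@ideal_exp_min J [set f | ideal_exp J m.+1 (x * f)]).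
  split=> /= [|a b|a b]; first by rewrite mulr0.
    by rewrite mulrDr; apply: ED.
  by rewrite mulrCA; apply: EM.
move=> g Jg; apply: sub_gen_ideal.
exists (fun i => if unlift ord0 i is Some j then g j else x); split.
  by move=> i; case: unliftP.
rewrite big_ord_recl unlift_none; congr (_ * _).
by apply: eq_bigr => i _; rewrite liftK.
Qed.

Lemma ideal_exp_leq J m p : (m <= p)%N -> ideal_exp J p `<=` ideal_exp J m.
Proof.
move=> /subnKC <-; elim: (p - m)%N => [|d IHd]; first by rewrite addn0.
rewrite addnS; apply: subset_trans IHd.
apply: ideal_exp_min => [|g Jg]; first exact: is_ideal_exp.
rewrite big_ord_recl; have [_ _ EM] := is_ideal_exp J (m + d).
apply/EM/sub_gen_ideal; exists (g \o lift ord0).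
by split=> // i; apply: Jg.
Qed.

Lemma ideal_exp_prod J (I : Type) (P : pred I) (F : I -> R) (r : seq I) :
  (forall i, P i -> J (F i)) -> ideal_exp J (count P r) (\prod_(i <- r) F i).
Proof.
move=> JF; elim: r => [|i r IHr] /=.
  rewrite big_nil; apply: sub_gen_ideal; exists (fun=> 1).
  by split; [case | rewrite big_ord0].
rewrite big_cons; case: (boolP (P i)) => [Pi|_].
  by apply/ideal_exp_mull/IHr/JF.
by have [_ _ EM] := is_ideal_exp J (count P r); apply: EM.
Qed.

End IdealPowers.

(** * Linear forms and the prime ideals of points *)

Lemma linear_formE (R : comNzRingType) (n : nat) (l : {mpoly R[n]}) :
  l \is 1.-homog -> l = \sum_i l@_U_(i) *: 'X_i.
Proof.
move=> hl; apply/mpolyP => m; rewrite raddf_sum /=.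
under eq_bigr do rewrite mcoeffZ mcoeffX.
have [/eqP/mdeg1P[j /eqP ->]|m1] := eqVneq (mdeg m) 1%N.
  rewrite (bigD1 j) //= eqxx mulr1 big1 ?addr0 // => i ij.
  by rewrite eq_mnm1 (negbTE ij) mulr0.
rewrite (dhomog_nemf_coeff hl m1) big1 // => i _.
by case: eqP => [mE|_]; [rewrite -mE mdeg1 in m1 | rewrite mulr0].
Qed.

Section Points.
Variables (k : closedFieldType) (n v : nat) (ell : 'I_v -> {mpoly k[n.+1]}).
Implicit Types (s : {set 'I_v}) (u a b : 'rV[k]_n.+1) (F G l : {mpoly k[n.+1]}).
Hypothesis ell_homog : forall j, ell j \is 1.-homog.

Lemma is_ideal_point s : is_ideal (point_ideal ell s).
Proof. exact: is_ideal_gen. Qed.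

Lemma mem_point_ideal s j : j \in s -> point_ideal ell s (ell j).
Proof. by move=> js; apply: sub_gen_ideal; exists j. Qed.

Lemma ev_form l u : l \is 1.-homog -> ev l u = \sum_i l@_U_(i) * u 0 i.
Proof.
move=> hl; rewrite {1}(linear_formE hl) /ev raddf_sum /=.
by apply: eq_bigr => i _; rewrite mevalZ mevalXU.
Qed.

(** Linear duality: the columns of the cokernel of the coefficient matrix are vectors of the flat,
    so [l] kills them and its coefficient row lies in the row space. Rows with index outside [s] are
    set to zero. *)
Lemma linear_form_span s l : l \is 1.-homog ->
  (forall u, flat ell s u -> ev l u = 0) -> point_ideal ell s l.
Proof.
move=> hl l0.
pose M := \matrix_(j < v, i < n.+1) if j \in s then (ell j)@_U_(i) else 0.
pose lr := \row_(i < n.+1) l@_U_(i).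
have /submxP[D lrE] : (lr <= M)%MS.
  rewrite submxE; apply/eqP/matrixP => x c; rewrite !mxE.
  rewrite -[RHS](l0 (col c (cokermx M))^T).
    by rewrite ev_form //; apply: eq_bigr => i _; rewrite !mxE.
  move=> j js; have := congr1 (fun A : 'M_(v, n.+1) => A j c) (mulmx_coker M).
  rewrite !mxE ev_form // => Mj; rewrite -[RHS]Mj; apply: eq_bigr => i _.
  by rewrite !mxE js.
have -> : l = \sum_(j | j \in s) D 0 j *: ell j.
  rewrite (linear_formE hl).
  under [RHS]eq_bigr do rewrite (linear_formE (ell_homog _)) scaler_sumr.
  rewrite exchange_big /=; apply: eq_bigr => i _.
  have -> : l@_U_(i) = lr 0 i by rewrite mxE.
  rewrite lrE mxE scaler_suml [RHS]big_mkcond; apply: eq_bigr => j _.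
  by rewrite !mxE; case: ifP; rewrite ?mulr0 ?scale0r // scalerA.
have [J0 JD JM] := is_ideal_point s.
apply: (big_ind (point_ideal ell s)) => // j js.
by rewrite -mul_mpolyC; apply/JM/mem_point_ideal.
Qed.

(** Exhibits the ideal as the kernel of a ring map into k[X], whence its primality. Conversely, if
    a_i0 is nonzero, replacing each X_i by (a_i / a_i0) X_i0 changes F only modulo the ideal and
    turns it into a polynomial that vanishes everywhere. *)
Lemma point_idealP s a : a != 0 -> flat ell s a ->
    (forall u, flat ell s u -> exists c, u = c *: a) ->
  forall F, point_ideal ell s F <-> along 0 a F = 0.
Proof.
move=> a0 sa line F; split.
  move: F; apply: (@gen_ideal_min _ _ [set F | along 0 a F = 0]%classic).
    split=> [|f g|f g]; rewrite /= ?rmorph0 ?rmorphD ?rmorphM //=.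
      by move=> -> ->; rewrite addr0.
    by move=> ->; rewrite mulr0.
  move=> _ [j js <-] /=; rewrite along_linear // sa // scale0r addr0.
  by rewrite -(scale0r a) ev_linearZ // mul0r.
move=> Fa; have [i0 ai0] : exists i, a 0 i != 0 by apply/rV0Pn.
pose x := [tuple 'X_i : {mpoly k[n.+1]} | i < n.+1].
pose y := [tuple (a 0 i / a 0 i0) *: 'X_i0 : {mpoly k[n.+1]} | i < n.+1].
have := @comp_mpoly_congr k n.+1 n.+1 (point_ideal ell s) F x y
  (is_ideal_point s).
rewrite comp_mpoly_id (_ : F \mPo y = 0) ?subr0.
  apply=> i; rewrite !tnth_mktuple; apply: linear_form_span.
    by rewrite rpredB ?rpredZ // dhomogX; apply/eqP/mdeg1.
  move=> _ /line[c ->]; rewrite /ev mevalB mevalZ !mevalXU !mxE.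
  by field.
apply/eqP/negPn/negP => /mpoly_nonroot[z].
rewrite comp_mpoly_meval.
rewrite (meval_eq (v2 := fun i => (0 + (z i0 / a 0 i0) *: a) 0 i)).
  by rewrite -/(ev F _) -along_horner Fa horner0 eqxx.
move=> i; rewrite tnth_mktuple mevalZ mevalXU !mxE add0r; ring.
Qed.

Lemma point_ideal_prime s a : a != 0 -> flat ell s a ->
    (forall u, flat ell s u -> exists c, u = c *: a) ->
  is_prime_ideal (point_ideal ell s).
Proof.
move=> a0 sa line; have pP := point_idealP a0 sa line.
split; first exact: is_ideal_point.
  by move/pP/eqP; rewrite rmorph1 oner_eq0.
move=> f g /pP/eqP; rewrite rmorphM mulf_eq0.
by move=> /orP[] /eqP /pP; [left|right].
Qed.

(** Along a line through [a] every generator of the point ideal becomes a multiple of X. *)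
Lemma ideal_exp_order s h F a b : ideal_exp (point_ideal ell s) h F ->
  flat ell s a -> 'X^h %| along a b F.
Proof.
move=> + sa; move: F.
apply: (@ideal_exp_min _ _ [set F | 'X^h %| along a b F]%classic).
  split=> [|f g|f g] /=; rewrite ?rmorph0 ?dvdp0 ?rmorphD ?rmorphM //=.
    exact: dvdp_add.
  by move=> ?; apply: dvdp_mull.
move=> g Jg /=; rewrite rmorph_prod /= -[h in 'X^h]card_ord -prodr_const.
apply: (big_ind2 (fun p q : {poly k} => p %| q)) => // [p p' q q'|i _].
  exact: dvdp_mul.
move: {Jg}(g i) (Jg i).
apply: (@gen_ideal_min _ _ [set F | 'X %| along a b F]%classic).
  split=> [|f f'|f f'] /=; rewrite ?rmorph0 ?dvdp0 ?rmorphD ?rmorphM //=.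
    exact: dvdp_add.
  by move=> ?; apply: dvdp_mull.
move=> _ [j js <-] /=; rewrite along_linear // sa // add0r -mul_polyC.
exact: dvdp_mull.
Qed.

End Points.

(** * Initial degree *)

Section Alpha.
Variables (R : comNzRingType) (n : nat).
Implicit Types J : set {mpoly R[n]}.

Lemma alphaP J d : has_form J d -> has_form J (alpha J) /\ (alpha J <= d)%N.
Proof.
move=> Jd; have ex : exists e, `[< has_form J e >] by exists d; apply/asboolP.
case: (ex_minnP ex) => e /asboolP Je emin.
have := @xgetPex _ 0%N
  [set d | has_form J d /\ forall e, has_form J e -> (d <= e)%N]%classic.
case=> [|Ja amin]; last by split=> //; apply: amin.
by exists e; split=> // f Jf; apply/emin/asboolP.
Qed.

End Alpha.

(** * From nonzero vectors to projective points *)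

Section Projective.
Variables (k : fieldType) (n : nat).
Implicit Types (u : 'rV[k]_n.+1).

Lemma line_dim u : u != 0 -> \dim <[u]>%VS == 1%N.
Proof. by move=> u0; rewrite dim_vline u0. Qed.

Definition proj_point u (u0 : u != 0) : proj_space k n :=
  exist (fun L : {vspace 'rV[k]_n.+1} => is_true (\dim L == 1%N)) _
    (line_dim u0).

Lemma hyperplane_proj_point (l : {mpoly k[n.+1]}) u (u0 : u != 0) :
  l \is 1.-homog -> ev l u = 0 -> hyperplane l (proj_point u0).
Proof.
by move=> hl lu _ /vlineP[c ->]; rewrite -/(ev l _) ev_linearZ // lu mulr0.
Qed.

End Projective.

(** * Intersections of blocks in a Steiner system *)

Section Steiner.
Variables (t n v : nat) (B : {set {set 'I_v}}).
Hypotheses (t_gt0 : (0 < t)%N) (t_lt : (t < n)%N).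
Hypothesis steinerB : steiner_system B t n v.

Lemma steiner_card b : b \in B -> #|b| = n.
Proof. by case: steinerB => _ + _; apply. Qed.

Lemma steiner_block_eq (S b c : {set 'I_v}) :
  (t <= #|S|)%N -> b \in B -> c \in B -> S \subset b -> S \subset c -> b = c.
Proof.
move=> tS bB cB Sb Sc; case: steinerB => _ _ uniq.
have [||T [_ TS cT]] := @subset_of_card _ finset.set0 S t;
  rewrite ?finset.sub0set ?cards0 //.
have [d [_ dE]] := uniq T cT.
rewrite -(dE b) ?bB ?(fintype.subset_trans TS) //.
by rewrite -(dE c) ?cB ?(fintype.subset_trans TS).
Qed.

Lemma steiner_block_ex (S : {set 'I_v}) : (#|S| <= t <= v)%N ->
  exists2 b, b \in B & S \subset b.
Proof.
move=> /andP[St tv]; case: steinerB => _ _ uniq.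
have [||T [ST _ cT]] := @subset_of_card _ S [set: 'I_v]%SET t.
- exact: finset.subsetT.
- by rewrite St cardsT card_ord.
have [b [/andP[bB Tb] _]] := uniq T cT.
by exists b => //; apply: fintype.subset_trans Tb.
Qed.

Lemma steiner_sparse (S : {set 'I_v}) i j :
  #|S| = n.-1 -> i \notin S -> j \notin S ->
  i |: S \in B -> j |: S \in B -> i = j.
Proof.
move=> cS iS jS iB jB; have eqS : i |: S = j |: S.
  by apply: (@steiner_block_eq S) => //; rewrite ?finset.subsetUr // cS; lia.
have : i \in j |: S by rewrite -eqS finset.setU11.
by rewrite !inE (negbTE iS) orbF => /eqP.
Qed.

(** A non-block [s] has a point [x] outside a given block [b]; let [c] be a block through [x]. If v
    <= n + 1, then b and c share at least n - 1 >= t elements and coincide, a contradiction. *)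
Lemma steiner_points : non_blocks n B != finset.set0 -> (n.+1 < v)%N.
Proof.
case/set0Pn => s; rewrite !inE => /andP[sB /eqP sn].
have nv : (n <= v)%N by rewrite -sn -[v in leqRHS]card_ord max_card.
have [b bB _] : exists2 b, b \in B & finset.set0 \subset b.
  by apply: steiner_block_ex; rewrite cards0; lia.
have nb := steiner_card bB.
have cb : #|~: b| = (v - n)%N by rewrite cardsCs finset.setCK card_ord nb.
have [x xb] : exists x, x \notin b.
  have : b != s by apply: contraNneq sB => <-.
  have : ~~ (s \subset b) || (b == s).
    rewrite -implybE; apply/implyP => sb.
    by rewrite eq_sym eqEcard sb nb sn leqnn.
  by case: eqP => // _; rewrite orbF => /subsetPn[x _ xb] _; exists x.
have [c cB xc] : exists2 c, c \in B & [set x]%SET \subset c.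
  by apply: steiner_block_ex; rewrite cards1; lia.
rewrite ltnNge; apply/negP => vn.
have bc : b = c.
  apply: (@steiner_block_eq (b :&: c)) => //;
    [|exact: finset.subsetIl|exact: finset.subsetIr].
  have := cardsUI b c; rewrite nb (steiner_card cB).
  have : (#|b :|: c| <= v)%N by rewrite -[v in leqRHS]card_ord max_card.
  lia.
by move: xb; rewrite bc -finset.sub1set xc.
Qed.

End Steiner.

(** * Associated primes of the complement and the upper bound *)

Section Configuration.
Variables (k : closedFieldType) (n v : nat) (B : {set {set 'I_v}}).
Variable ell : 'I_v -> {mpoly k[n.+1]}.
Hypothesis n_gt0 : (0 < n)%N.
Hypothesis ell_form : forall j, is_linear_form (ell j).
Hypothesis proper : meets_properly ell.
Implicit Types (s : {set 'I_v}) (u a : 'rV[k]_n.+1).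

Let ell_homog j : ell j \is 1.-homog := (ell_form j).2.

Local Notation I := (complement_ideal ell B).

Lemma flat_line s : #|s| = n -> exists a, [/\ a != 0, flat ell s a &
  forall u, flat ell s u -> exists c, u = c *: a].
Proof.
move=> sn; have [P [sP uniqP]] := proper.1 s sn.
have dimP : \dim (sval P) = 1%N := eqP (svalP P).
have a0 : vpick (sval P) != 0 by rewrite vpick0 -dimv_eq0 dimP.
exists (vpick (sval P)); split => // [i si|u su].
  exact: (sP i si _ (memv_pick _)).
have [->|u0] := eqVneq u 0; first by exists 0; rewrite scale0r.
have uP : P = proj_point u0.
  by apply: uniqP => i si; apply: hyperplane_proj_point => //; apply: su.
apply/vlineP; have <- : sval P = <[vpick (sval P)]>%VS.
  by apply/esym/eqP; rewrite eqEdim -memvE memv_pick dimP dim_vline a0.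
by rewrite uP; apply: memv_line.
Qed.

Lemma flat_eq0_card s u : #|s| = n.+1 -> flat ell s u -> u = 0.
Proof.
move=> sn su; apply/eqP/negPn/negP => u0.
have /= := proper.2 s sn; rewrite -subset0 => /(_ (proj_point u0)); apply.
by move=> i si; apply: hyperplane_proj_point => //; apply: su.
Qed.

Lemma is_ideal_complement : is_ideal I.
Proof.
split=> [|f g If Ig|a f If] s sB.
- by have [] := is_ideal_point ell s.
- by have [_ + _] := is_ideal_point ell s; apply; [apply: If | apply: Ig].
- by have [_ _ +] := is_ideal_point ell s; apply; apply: If.
Qed.

(** The witness is [generic_poly ell s]: it vanishes at every other point, whose index set contains
    some j outside [s], but not at P_s. *)
Lemma Ass_point_ideal s : s \in non_blocks n B -> Ass I (point_ideal ell s).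
Proof.
move=> sB; have sn : #|s| = n by move: sB; rewrite !inE => /andP[_ /eqP].
have [a [a0 sa line]] := flat_line sn.
split; first exact: (point_ideal_prime ell_homog a0 sa line).
exists (generic_poly ell s); apply/predeqP => g; split=> [sg r rB|/(_ s sB)].
  have rn : #|r| = n by move: rB; rewrite /= !inE => /andP[_ /eqP].
  have [_ _ rM] := is_ideal_point ell r.
  have [rs|] := eqVneq r s; first by rewrite mulrC rs in rM *; apply: rM.
  rewrite eqEcard rn sn leqnn andbT => /subsetPn[j jr js].
  by rewrite /generic_poly (bigD1 j) //= mulrCA mulrC; apply/rM/mem_point_ideal.
have [_ _ sprime] := point_ideal_prime ell_homog a0 sa line.
move=> /sprime[//|/(point_idealP ell_homog a0 sa line)].
rewrite rmorph_prod /= => /eqP/prodf_eq0[j js] /eqP aj0.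
have /eqP := congr1 (horner^~ 1) aj0.
rewrite along_horner scale1r add0r horner0 => /eqP aj.
have : a = 0.
  by apply: (@flat_eq0_card (j |: s)); [rewrite cardsU1 js sn | apply: flatU1].
by move/eqP; rewrite (negbTE a0).
Qed.

(** Otherwise each point ideal has an element outside [p]; the product of these lies in I, hence in
    [p], against primality. *)
Lemma Ass_above_point p : Ass I p ->
  exists2 s, s \in non_blocks n B & (point_ideal ell s `<=` p)%classic.
Proof.
move=> [[_ p1 pprime] [f pE]].
have Ip : (I `<=` p)%classic.
  move=> g Ig; rewrite pE /= mulrC.
  by have [_ _ IM] := is_ideal_complement; apply: IM.
apply: contrapT => nos.
have [g [pg gs]] : exists g, ~ p g /\
    {in enum (non_blocks n B), forall s, point_ideal ell s g}.
  have : {in enum (non_blocks n B),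
      forall s, ~ (point_ideal ell s `<=` p)%classic}.
    by move=> s; rewrite mem_enum => sB sp; apply: nos; exists s.
  elim: (enum _) => [_|s r IHr nsp]; first by exists 1; split.
  have [|g [pg gr]] := IHr.
    by move=> t tr; apply: nsp; rewrite inE tr orbT.
  have /existsNP[h /not_implyP[sh ph]] := nsp s (mem_head _ _).
  exists (h * g); split; first by move/pprime => [].
  move=> t; rewrite inE => /orP[/eqP ->|/gr tg].
    by have [_ _ M] := is_ideal_point ell s; rewrite mulrC; apply: M.
  by have [_ _ M] := is_ideal_point ell t; apply: M.
by apply/pg/Ip => s sB; apply: gs; rewrite mem_enum.
Qed.

Lemma symbolic_power_form m (r : seq 'I_v) :
  (forall s, #|s| = n -> (m <= count (mem s) r)%N) ->
  has_form (symbolic_power I m) (size r).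
Proof.
move=> mr; exists (\prod_(i <- r) ell i); split.
- move=> p /Ass_above_point[s sB sp]; apply: (ideal_expS sp).
  have sn : #|s| = n by move: sB; rewrite !inE => /andP[_ /eqP].
  apply: (ideal_exp_leq (mr s sn)); apply: ideal_exp_prod => i.
  exact: mem_point_ideal.
- by rewrite prodf_seq_neq0; apply/allP => i _; apply: (ell_form i).1.
- elim: r {mr} => [|i r IHr]; first by rewrite big_nil dhomog1.
  by rewrite big_cons /=; apply: (dhomogM (d := 1)).
Qed.

(** The term n is added on both sides to avoid a truncated subtraction next to [alpha]. *)
Lemma alpha_symbolic_power_le m : (n < v)%N ->
  (n * (alpha (symbolic_power I m) + n) <= (m + n - 1) * v + n)%N /\
  has_form (symbolic_power I m) (alpha (symbolic_power I m)).
Proof.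
move=> nv; case: m => [|m].
  have [al_form] := alphaP (@symbolic_power_form 0 [::] (fun _ _ => leq0n _)).
  by rewrite leqn0 => /eqP a0; split=> //; rewrite a0; nia.
(* After the case split [m] stands for the exponent minus one. *)
pose q := (m %/ n)%N; pose e := (m %% n)%N.
have mE : m = (q * n + e)%N by exact: divn_eq.
have en : (e < n)%N by rewrite ltn_mod.
(* By inclusion-exclusion a set of this size meets every n-subset in at least e + 1 elements; e < n
   makes it fit into V. *)
have [||S [_ _ cS]] :=
  @subset_of_card _ finset.set0 [set: 'I_v]%SET (v - n + e.+1).
- exact: finset.subsetT.
- by rewrite cards0 cardsT card_ord; lia.
pose r := flatten (nseq q (enum 'I_v)) ++ enum S.
have count_enum (T s : {set 'I_v}) : count (mem s) (enum T) = #|s :&: T|.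
  rewrite -sum1_count big_enum_cond /= -sum1_card; apply: eq_bigl => i.
  by rewrite !inE andbC.
have [|al_form al_le] := alphaP (@symbolic_power_form m.+1 r _).
  move=> s sn; rewrite /r count_cat count_flatten map_nseq sumn_nseq count_enum.
  have -> : count (mem s) (enum 'I_v) = n.
    by rewrite -sn -sum1_count big_enum_cond /= -sum1_card.
  have := cardsUI s S; rewrite sn cS.
  have : (#|s :|: S| <= v)%N by rewrite -[v in leqRHS]card_ord max_card.
  by rewrite mE; nia.
split=> //; move: al_le.
rewrite size_cat size_flatten /shape map_nseq sumn_nseq -!cardE card_ord cS mE.
move: (alpha _) => A; nia.
Qed.

End Configuration.

Theorem corollary3p8 (k : closedFieldType) (hk : [pchar k] =i pred0)
  (t n v : nat) (ht : (0 < t)%N) (htn : (t < n)%N) (hnv : (n <= v)%N)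
  (B : {set {set 'I_v}}) (hB : steiner_system B t n v)
  (hXC : non_blocks n B != finset.set0)
  (ell : 'I_v -> {mpoly k[n.+1]})
  (hell : forall j, is_linear_form (ell j))
  (hdistinct : injective (fun j => hyperplane (ell j)))
  (hmeet : meets_properly ell)
  (m h : nat) (hh : (1 < h)%N) :
  let I := complement_ideal ell B in
  ((alpha (symbolic_power I m))%:R + n%:R - 1) / (m%:R + n%:R - 1)
    <= (alpha (symbolic_power I h))%:R / h%:R :> rat.
Proof.
cbv zeta; set I := complement_ideal ell B.
have n1 : (1 < n)%N by lia.
have vn : (n.+1 < v)%N by apply: (steiner_points ht htn hB).
have [upper _] := alpha_symbolic_power_le B (ltnW n1) hell m (ltnW vn).
have [_ [F [IF F0 Fhom]]] :=
  alpha_symbolic_power_le B (ltnW n1) hell h (ltnW vn).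
(* [msize] is the degree plus one. *)
have Fsize : (msize F).-1 = alpha (symbolic_power I h).
  exact: dhomog_uniq F0 (dhomog_msize Fhom) Fhom.
have hom j := (hell j).2.
have lower : (h * v <= n * alpha (symbolic_power I h))%N.
  rewrite -Fsize; apply: (@order_bound _ _ _ ell _ _ _ n1 vn B) => //.
  - by move=> s /(flat_line hell hmeet)[a [a0 sa _]]; exists a.
  - by move=> s u; apply: (flat_eq0_card hell hmeet).
  - exact: (steiner_sparse ht htn hB).
  move=> s a b sn _ sB sa _ _; apply: (ideal_exp_order hom) sa.
  apply: IF; apply: (Ass_point_ideal hell hmeet).
  by rewrite !inE sB sn /=.
rewrite -/I in upper; move: upper lower.
set A := alpha _; set C := alpha _ => upper lower.
(* After multiplication by n: n (A + n - 1) h <= (m + n - 1) v h <= n C (m + n - 1). *)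
have {upper lower} AC : ((A + n - 1) * h <= C * (m + n - 1))%N.
  rewrite -(leq_pmul2l (ltnW n1)).
  have -> : (n * (C * (m + n - 1)) = (n * C) * (m + n - 1))%N by rewrite mulnA.
  apply: leq_trans (leq_mul lower (leqnn _)).
  have {}upper : (n * (A + n - 1) <= (m + n - 1) * v)%N.
    by rewrite mulnBr muln1 leq_subLR [(n + _)%N]addnC.
  rewrite mulnA (leq_trans (leq_mul upper (leqnn h))) //.
  by rewrite -mulnA [(v * h)%N]mulnC mulnC.
(* Truncated and rational subtraction agree since n >= 1. *)
have natB1 x : (x%:R + n%:R - 1 = (x + n - 1)%:R :> rat).
  by rewrite natrB ?natrD //; lia.
rewrite !natB1 ler_pdivrMr ?ltr0n; last by lia.
rewrite mulrAC ler_pdivlMr ?ltr0n ?(ltnW hh) //.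
by rewrite -!natrM ler_nat.
Qed.
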